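(* Let $n\geq 2$ and $k\geq 1$ be integers. Let $HM_{n,k}$ (resp. $PM_{n,k}$) be the total number of humps (resp. peaks) of height $k$ in all Motzkin paths of order $n$, i.e. the number of pairs $(M,P)$ where $M$ is a Motzkin path of order $n$ and $P$ is a hump (resp. peak) of $M$ of height $k$. Then \begin{align*} HM_{n,k}&=\sum_{j=0}^{n-2k}\chi(j\equiv n \pmod 2)\,\frac{4k}{n-j+2k}\binom{n}{j}\binom{n-j-1}{(n-j)/2+k-1},\\ PM_{n,k}&=\sum_{j=0}^{n-2k}\chi(j\equiv n \pmod 2)\,\frac{4k}{n-j+2k}\binom{n-1}{j}\binom{n-j-1}{(n-j)/2+k-1}, \end{align*} where $\chi(\cdot)$ equals $1$ if the condition holds and $0$ otherwise. Moreover, the summation index $j$ counts the number of flat steps of the corresponding Motzkin paths (i.e. the $j$-th summand counts those pairs $(M,P)$ in which $M$ has exactly $j$ flat steps).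
   Context: A Motzkin path of order $n$ is a lattice path from $(0,0)$ to $(n,0)$ using up steps $U=(1,1)$, down steps $D=(1,-1)$ and flat steps $F=(1,0)$ that never goes below the $x$-axis. A hump in a Motzkin path is a consecutive sequence of steps consisting of an up step, followed by zero or more flat steps, followed by a down step; a peak is a hump with no flat steps. The height of a hump is the $y$-coordinate reached by the up step of the hump. *)

(* Defs.v *)
From HB Require Import structures.
From mathcomp Require Import all_boot all_order all_algebra.

Set Implicit Arguments.
Unset Strict Implicit.
Unset Printing Implicit Defensive.

Import Order.TTheory GRing.Theory Num.Theory.
Local Open Scope ring_scope.

Inductive step := U | D | F.

Definition ord_of_step (s : step) : 'I_3 :=
  match s with U => inord 0 | D => inord 1 | F => inord 2 end.

Definition step_of_ord (i : 'I_3) : step :=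
  match val i with 0%N => U | 1%N => D | _ => F end.

Lemma ord_of_stepK : cancel ord_of_step step_of_ord.
Proof. by case; rewrite /step_of_ord /= inordK. Qed.

HB.instance Definition _ := Finite.copy step (can_type ord_of_stepK).

Definition rise (s : step) : int :=
  match s with U => 1 | D => -1 | F => 0 end.

Definition height (w : seq step) : int := \sum_(s <- w) rise s.

(* A path of order n is an n-tuple of steps: every step advances the abscissa
   by 1, so ending at (n, 0) means having n steps and final height 0. *)
Definition motzkin n (M : n.-tuple step) : bool :=
  [forall i : 'I_n.+1, 0 <= height (take i M)] && (height M == 0).

(* The pair (i, m) represents the hump U F^m D of M whose up step is step
   number i (counted from 0). *)
Definition is_hump (M : seq step) (i m : nat) : bool :=
  take m.+2 (drop i M) == U :: rcons (nseq m F) D.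

Definition is_peak (M : seq step) (i m : nat) : bool :=
  is_hump M i m && (m == 0%N).

Definition hump_height (M : seq step) (i : nat) : int := height (take i.+1 M).

Definition flats (M : seq step) : nat := count_mem F M.

(* A hump of a path of order n has i < n and m < n, so letting i and m range
   over 'I_n loses nothing. *)
Definition humps (n k : nat) : {set n.-tuple step * ('I_n * 'I_n)} :=
  [set x : n.-tuple step * ('I_n * 'I_n) |
    [&& motzkin x.1, is_hump x.1 x.2.1 x.2.2
        & hump_height x.1 x.2.1 == k%:Z]].

Definition peaks (n k : nat) : {set n.-tuple step * ('I_n * 'I_n)} :=
  [set x : n.-tuple step * ('I_n * 'I_n) |
    [&& motzkin x.1, is_peak x.1 x.2.1 x.2.2
        & hump_height x.1 x.2.1 == k%:Z]].

Definition HM (n k : nat) : nat := #|humps n k|.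

Definition PM (n k : nat) : nat := #|peaks n k|.

(* Natural-number subtraction and halving are exact for the j of interest,
   namely j <= n - 2k with j congruent to n modulo 2 (and k >= 1). *)
Definition hump_summand (n k j : nat) : rat :=
  (j == n %[mod 2])%:R * ((4 * k)%:R / (n - j + 2 * k)%:R)
  * 'C(n, j)%:R * 'C(n - j - 1, (n - j) %/ 2 + k - 1)%:R.

Definition peak_summand (n k j : nat) : rat :=
  (j == n %[mod 2])%:R * ((4 * k)%:R / (n - j + 2 * k)%:R)
  * 'C(n - 1, j)%:R * 'C(n - j - 1, (n - j) %/ 2 + k - 1)%:R.

(* Main.v *)
Require Import Defs.
From mathcomp Require Import all_boot all_order all_algebra.
From mathcomp Require Import zify ring.

(* A hump of height k splits the path as a U F^m D b, with a going from 0 to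
   k-1 and b from k-1 to 0. Deleting U F^m and traversing a backwards turns it into the
   walk a^r D b of length n-1-m from 2k-1 to 0, from which a is recovered at
   the first passage to k-1. Nonnegative walks from h to 0 with f flat steps
   and u up steps have an explicit number (a ballot number times a binomial
   coefficient), with h = 2k-1 here. Taking m = 0 counts the peaks; for the
   humps, summing over m only affects one factor C(n-1-m, j-m), whose sum is
   C(n, j) by the hockey-stick identity. *)

Import Order.TTheory GRing.Theory Num.Theory.
Local Open Scope ring_scope.

(** * Nonnegative walks and their reversal *)

(** Final height of the walk that starts at [h], with [None] as soon as it would step below 0:
    nonnegativity is thus checked step by step, without quantifying over prefixes. *)
Fixpoint walk (h : nat) (w : seq step) : option nat :=
  if w is s :: w' then
    match s, h with
    | U, _ => walk h.+1 w'
    | D, h'.+1 => walk h' w'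
    | D, 0%N => None
    | F, _ => walk h w'
    end
  else Some h.

Definition flip_step (s : step) : step :=
  match s with U => D | D => U | F => F end.

Definition flip_rev (w : seq step) : seq step := rev (map flip_step w).

Lemma size_flip_rev w : size (flip_rev w) = size w.
Proof. by rewrite size_rev size_map. Qed.

Lemma flip_revK : involutive flip_rev.
Proof.
move=> w; rewrite /flip_rev map_rev revK -map_comp.
by rewrite -[RHS]map_id; apply: eq_map; case.
Qed.

Lemma flats_cons s w : flats (s :: w) = ((if s is F then 1 else 0) + flats w)%N.
Proof. by rewrite /flats /=; case: eqP => [->|]; case: s. Qed.

Lemma flats_cat v w : flats (v ++ w) = (flats v + flats w)%N.
Proof. exact: count_cat. Qed.

Lemma flats_flip_rev w : flats (flip_rev w) = flats w.
Proof.
elim: w => // s w IHw; rewrite /flip_rev map_cons rev_cons -cats1 flats_cat.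
by rewrite -/(flip_rev w) IHw !flats_cons addnC; case: s.
Qed.

Lemma walk_cat h v w : walk h (v ++ w) = obind (walk^~ w) (walk h v).
Proof. by elim: v h => [|[] v IHv] [|h] //=. Qed.

Lemma walk_addr c h w e : walk h w = Some e -> walk (h + c) w = Some (e + c)%N.
Proof.
elim: w h => [|s w IHw] h /=; first by case=> <-.
by case: s h => [] [|h] //= /IHw.
Qed.

Lemma walk_flip_rev h w e : walk h w = Some e -> walk e (flip_rev w) = Some h.
Proof.
elim: w h => [|s w IHw] h /=; first by case=> ->.
rewrite /flip_rev map_cons rev_cons -cats1 walk_cat -/(flip_rev w).
by case: s h => [] [|h] //= /IHw ->.
Qed.

Lemma walk_split h v w e : walk h (v ++ w) = Some e ->
  exists2 c, walk h v = Some c & walk c w = Some e.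
Proof. by rewrite walk_cat; case: (walk h v) => //= c wc; exists c. Qed.

(** Here [u] and [d] are the numbers of up and down steps. *)
Lemma walk_counts h w e : walk h w = Some e ->
  exists u d, [/\ size w = (u + d + flats w)%N & h + u = e + d]%N.
Proof.
elim: w h => [|s w IHw] h; first by case=> ->; exists 0%N, 0%N.
rewrite flats_cons /=.
case: s h => [h|[|h]|h] //= /IHw [u [d [-> E]]].
- by exists u.+1, d; split; lia.
- by exists u, d.+1; split; lia.
- by exists u, d; split; lia.
Qed.

(** * Walks and Motzkin paths *)

Lemma height_cat v w : height (v ++ w) = height v + height w.
Proof. exact: big_cat. Qed.

Lemma height_cons s w : height (s :: w) = rise s + height w.
Proof. exact: big_cons. Qed.

Lemma walkP h w e :
  walk h w = Some e <->
  (forall i, 0 <= h%:Z + height (take i w)) /\ h%:Z + height w = e%:Z.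
Proof.
have h0 : height [::] = 0 by exact: big_nil.
elim: w h => [|s w IHw] h /=.
  by rewrite h0 addr0; split=> [[->]|[_ [->]]].
have step_iff h' : h'%:Z = h%:Z + rise s -> (walk h' w = Some e <->
   (forall i, 0 <= h%:Z + height (take i (s :: w))) /\
     h%:Z + height (s :: w) = e).
  move=> E; rewrite height_cons addrA -E IHw; split=> -[P Q]; split=> //.
    by case=> [|i]; rewrite ?take0 ?h0 ?addr0 //= height_cons addrA -E.
  by move=> i; have := P i.+1; rewrite /= height_cons addrA -E.
(* Only [D] at height 0 escapes [step_iff]; there the prefix of length 1 already has negative
   height. *)
case: s h step_iff => [h|[|h]|h] /= S; try (by apply: S; lia).
split=> // -[/(_ 1%N)]; rewrite /= take0 height_cons h0 /=; lia.
Qed.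

Lemma motzkinP n (M : n.-tuple step) : motzkin M <-> walk 0 M = Some 0%N.
Proof.
rewrite walkP /motzkin; split.
  move=> /andP[/forallP P /eqP Q]; split; last by rewrite Q.
  move=> i; case: (leqP i n) => [|lt_n_i].
    by rewrite -ltnS => lt_i_n; have := P (Ordinal lt_i_n); rewrite add0r.
  by rewrite take_oversize ?size_tuple ?Q //; apply: ltnW.
case; rewrite add0r => P ->; rewrite andbT.
by apply/forallP=> i; have := P i; rewrite add0r.
Qed.

(** * First passages and factorization at a hump *)

(** The number [e] is the height above [K.+1]. Since the walk ends at or below [K], it must read
    some [D] at [e = 0]; the first one is the cut. *)
Lemma first_passage K e w f : walk (K.+1 + e) w = Some f -> (f <= K)%N ->
  exists a b, [/\ w = a ++ D :: b, walk e a = Some 0%N & walk K b = Some f].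
Proof.
elim: w e => [|s w IHw] e /=; first by case=> <-; lia.
case: s => /=.
- rewrite -addnS => /IHw IH /IH [a [b [-> ea bf]]].
  by exists (U :: a), b.
- case: e => [|e].
    by rewrite addn0 => wf _; exists [::], w.
  rewrite addnS -addSn => /IHw IH /IH [a [b [-> ea bf]]].
  by exists (D :: a), b.
- move=> /IHw IH /IH [a [b [-> ea bf]]].
  by exists (F :: a), b.
Qed.

(* Were [a1] shorter than [a2], the walk [a2] from [e] would already step
   below 0 right after [a1]. *)
Lemma first_passage_uniq e a1 b1 a2 b2 :
  walk e a1 = Some 0%N -> walk e a2 = Some 0%N ->
  a1 ++ D :: b1 = a2 ++ D :: b2 -> a1 = a2 /\ b1 = b2.
Proof.
elim: a1 a2 e => [|s a1 IH] [|t a2] e //=.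
- by move=> _ _ [].
- by move=> [->] E2 [E _]; rewrite -E in E2.
- by move=> E1 [E0] [E _]; rewrite E E0 in E1.
- move=> e1 e2 [st E]; rewrite -st in e2 *; clear st.
  (* After their common first step both walks start from the same height [e']. *)
  suff [e' E1 E2] : exists2 e', walk e' a1 = Some 0%N & walk e' a2 = Some 0%N.
    by have [-> ->] := IH _ _ E1 E2 E.
  by case: s e e1 e2 => [e|[|e]|e] //=; eexists; eauto.
Qed.

Lemma is_humpP (M : seq step) i m :
  reflect (exists2 a, size a = i & exists b, M = a ++ U :: nseq m F ++ D :: b)
          (is_hump M i m).
Proof.
apply: (iffP eqP) => [E|[a <- [b ->]]]; last first.
  rewrite drop_size_cat // -cat_cons -cat_rcons -rcons_cons.
  by rewrite take_size_cat // size_rcons /= size_nseq.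
exists (take i M).
  rewrite size_takel //; have := congr1 size E.
  by rewrite /= size_take size_drop size_rcons size_nseq; case: ltnP; lia.
exists (drop m.+2 (drop i M)).
by rewrite -[nseq m F ++ _]cat_rcons -cat_cons -E !cat_take_drop.
Qed.

(** * Counting walks by length and flat steps *)

Definition walks (h N f : nat) : {set N.-tuple step} :=
  [set w : N.-tuple step | (walk h w == Some 0%N) && (flats w == f)].

Lemma card_tuple_cons N (p : pred (seq step)) :
  #|[set w : N.+1.-tuple step | p w]| =
  (\sum_(s : step) #|[set w : N.-tuple step | p (s :: w)]|)%N.
Proof.
rewrite -sum1dep_card.
transitivity (\sum_(s : step)
    \sum_(w : N.-tuple step | p (s :: w)) 1)%N; last first.
  by apply: eq_bigr => s _; rewrite sum1dep_card.
rewrite pair_big_dep /=.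
rewrite (reindex (fun q : step * N.-tuple step => [tuple of q.1 :: q.2])) //=.
exists (fun w : N.+1.-tuple step => (thead w, [tuple of behead w])).
  by move=> [s w] _; rewrite theadE; congr (_, _); apply: val_inj.
by move=> w _; rewrite /= -tuple_eta.
Qed.

Lemma sum_step (G : step -> nat) : (\sum_(s : step) G s = G U + G D + G F)%N.
Proof.
have E : perm_eq (index_enum step) [:: U; D; F].
  apply: uniq_perm; first exact: index_enum_uniq.
    by rewrite /= !inE; do 3 (case: eqP => //).
  by move=> s; rewrite mem_index_enum !inE; case: s; rewrite eqxx ?orbT.
by rewrite (perm_big _ E) /= !big_cons big_nil addn0 addnA.
Qed.

(** A walk from [h] to 0 with [u] up steps has [u + h] down steps. *)
Lemma walks_eq0 h N f : (forall u, N <> 2 * u + h + f)%N ->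
  #|walks h N f| = 0%N.
Proof.
move=> noN; apply/eqP; rewrite cards_eq0; apply/eqP/setP=> w; rewrite !inE.
apply/negP=> /andP[/eqP/walk_counts [u [d [sz E]]] /eqP fl].
by apply: (noN u); move: sz E; rewrite size_tuple fl; lia.
Qed.

(** The terms correspond to a first step [U], [D], [F]. A zero term marks a down step at height 0 or
    a flat step when none is allowed. *)
Lemma card_walksS h N f :
  (#|walks h N.+1 f| = #|walks h.+1 N f|
     + (if h is h'.+1 then #|walks h' N f| else 0)
     + (if f is f'.+1 then #|walks h N f'| else 0))%N.
Proof.
rewrite /walks
  (card_tuple_cons N (fun w => (walk h w == Some 0%N) && (flats w == f))).
rewrite sum_step.
congr (_ + _ + _)%N.
- by apply: eq_card => w; rewrite !inE flats_cons.
- case: h => [|h]; last by apply: eq_card => w; rewrite !inE flats_cons.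
  by apply/eqP; rewrite cards_eq0; apply/eqP/setP => w; rewrite !inE.
- case: f => [|f]; last by apply: eq_card => w; rewrite !inE flats_cons.
  apply/eqP; rewrite cards_eq0; apply/eqP/setP => w.
  by rewrite !inE flats_cons andbF.
Qed.

(* The reflection principle would give a difference of binomials; in this
   product form the recursion on the first step is a polynomial identity. *)
Lemma card_walks u h f :
  (#|walks h (2 * u + h + f) f| * ((u + h).+1`! * u`! * f`!) =
     (2 * u + h + f)`! * h.+1)%N.
Proof.
move E: (2 * u + h + f)%N => N.
elim: N u h f E => [|N IHN] u h f E.
  have [-> [-> ->]] : u = 0%N /\ h = 0%N /\ f = 0%N by lia.
  rewrite (_ : walks 0 0 0 = setT) ?cardsT ?card_tuple //.
  by apply/setP=> w; rewrite !inE tuple0.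
rewrite card_walksS 2!mulnDl.
(* The three terms contribute [h.+2 * u], [h * (u + h).+1] and [h.+1 * f], which add up to
   [h.+1 * (2 * u + h + f)]. *)
have -> : (#|walks h.+1 N f| * ((u + h).+1`! * u`! * f`!) = N`! * (h.+2 * u))%N.
  case: u E => [|u] E; first by rewrite walks_eq0 //; lia.
  have /IHN H : (2 * u + h.+1 + f = N)%N by lia.
  by rewrite [RHS]mulnA -H [u.+1`!]factS addnS addSn; ring.
have -> : ((if h is h'.+1 then #|walks h' N f| else 0) *
    ((u + h).+1`! * u`! * f`!) = N`! * (h * (u + h).+1))%N.
  case: h E => [|h] E; first by rewrite mul0n muln0.
  have /IHN H : (2 * u + h + f = N)%N by lia.
  by rewrite [RHS]mulnA -H [(u + h.+1).+1`!]factS addnS; ring.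
have -> : ((if f is f'.+1 then #|walks h N f'| else 0) *
    ((u + h).+1`! * u`! * f`!) = N`! * (h.+1 * f))%N.
  case: f E => [|f] E; first by rewrite !muln0.
  have /IHN H : (2 * u + h + f = N)%N by lia.
  by rewrite [RHS]mulnA -H [f.+1`!]factS; ring.
by rewrite factS -E; ring.
Qed.

(** * Humps as walks from [2K+1] to 0 *)

Lemma walk_nseqF h m w : walk h (nseq m F ++ w) = walk h w.
Proof. by elim: m. Qed.

Lemma flats_hump a m b :
  flats (a ++ U :: nseq m F ++ D :: b) = (flats (flip_rev a ++ D :: b) + m)%N.
Proof.
rewrite !flats_cat flats_flip_rev !flats_cons flats_cat flats_cons.
by rewrite {2}/flats count_nseq /= eqxx; lia.
Qed.

Lemma humpsP n K (x : n.-tuple step * ('I_n * 'I_n)) :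
  x \in humps n K.+1 <->
  exists a b, [/\ x.1 = a ++ U :: nseq x.2.2 F ++ D :: b :> seq step,
    size a = x.2.1, walk 0 a = Some K & walk K b = Some 0%N].
Proof.
have hump_heightE a b : hump_height (a ++ U :: b) (size a) = height a + 1.
  rewrite /hump_height -cat_rcons take_size_cat ?size_rcons //.
  by rewrite -cats1 height_cat /height big_seq1.
case: x => M [i m]; rewrite inE /=; split.
  case/and3P=> /motzkinP M0 /is_humpP[a sz_a [b defM]] /eqP hump_k.
  exists a, b; move: M0 hump_k.
  rewrite defM -sz_a hump_heightE => /walk_split[c ac bc] hK.
  have /walkP[_ height_a] := ac.
  have cK : c = K by lia.
  by move: bc; rewrite /= walk_nseqF /= -cK.
case=> a [b [defM sz_a aK bK]]; apply/and3P; split.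
- by apply/motzkinP; rewrite defM walk_cat aK /= walk_nseqF.
- by apply/is_humpP; exists a => //; exists b.
- have /walkP[_ height_a] := aK.
  by rewrite defM -sz_a hump_heightE; apply/eqP; lia.
Qed.

(* A hump [a U F^m D b] at height K+1 corresponds to the walk from 2K+1 to 0
   whose first passage to K is the step [D] of [flip_rev a ++ D :: b]. *)
Lemma card_humps_length n N K j (m : 'I_n) : n = (N + m.+1)%N ->
  #|[set x in humps n K.+1 | (flats x.1 == j) && (x.2.2 == m)]| =
  #|[set w : N.-tuple step |
      (walk (K.+1 + K) w == Some 0%N) && (flats w + m == j)%N]|.
Proof.
move=> defn; set A := [set x in _ | _].
(* Dropping [m.+1] steps after the prefix removes [U F^m] and keeps the [D]. The default of [insubd]
   is never reached on [A], where the length is [N]. *)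
pose f (x : n.-tuple step * ('I_n * 'I_n)) : N.-tuple step :=
  insubd (nseq_tuple N F)
    (flip_rev (take x.2.1 x.1) ++ drop (x.2.1 + m.+1) x.1).
have AP x : x \in A -> exists a b,
    [/\ x.1 = a ++ U :: nseq m F ++ D :: b :> seq step, size a = x.2.1
      & x.2.2 = m]
    /\ [/\ walk 0 a = Some K, walk K b = Some 0%N
         & f x = flip_rev a ++ D :: b :> seq step].
  rewrite inE => /and3P[/humpsP[a [b [defM sz_a aK bK]]] _ /eqP x_m].
  rewrite x_m in defM; exists a, b; do 2!split=> //.
  rewrite /f defM -sz_a take_size_cat // drop_cat ltnNge leq_addr addKn /=.
  rewrite drop_size_cat ?size_nseq // val_insubd size_cat size_flip_rev /=.
  have := congr1 size defM.
  rewrite size_tuple size_cat /= size_cat size_nseq /=.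
  by case: eqP => //; lia.
have inj_f : {in A &, injective f}.
  move=> [M [i l]] [M' [i' l']].
  move=> /AP[a [b [[/= defM sz_a ->] [aK bK fx]]]].
  move=> /AP[a' [b' [[/= defM' sz_a' ->] [a'K b'K fx']]]].
  move/(congr1 val); rewrite /= fx fx' => E.
  have [Ea Eb] := first_passage_uniq _ _ _ _ _
    (walk_flip_rev _ _ _ aK) (walk_flip_rev _ _ _ a'K) E.
  have {}Ea := can_inj flip_revK Ea; subst a' b'.
  congr (_, (_, _)); apply: val_inj; first by rewrite /= defM defM'.
  by rewrite /= -sz_a -sz_a'.
rewrite -(card_in_imset inj_f); apply: eq_card => w.
apply/imsetP/idP => [[x xA ->]|].
  have [a [b [[defM _ _] [aK bK fx]]]] := AP x xA.
  move: xA; rewrite !inE fx => /and3P[_ + _].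
  rewrite defM flats_hump => ->; rewrite andbT walk_cat.
  (* The reversed prefix runs from [K] to 0; lifted by [K.+1] it runs from [2K+1] to [K.+1], and the
     next [D] reaches [K]. *)
  by rewrite addSnnS (walk_addr _ _ _ _ (walk_flip_rev _ _ _ aK)) /= bK.
rewrite inE => /andP[/eqP wK fl].
(* Surjectivity: cutting at the first passage to [K] and reversing the first part gives the
   preimage. *)
have [a [b [defw aK bK]]] := first_passage _ _ _ _ wK (leq0n K).
have sz_M : size (flip_rev a ++ U :: nseq m F ++ D :: b) == n.
  have := congr1 size defw; rewrite size_tuple !size_cat /= size_cat /=.
  by rewrite size_flip_rev size_nseq => ?; apply/eqP; lia.
have lt_a_n : (size a < n)%N.
  by move: sz_M; rewrite size_cat size_flip_rev => /eqP <- /=; lia.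
have xA : (Tuple sz_M, (Ordinal lt_a_n, m)) \in A.
  rewrite inE /= eqxx andbT flats_hump flip_revK -defw fl andbT.
  apply/humpsP; exists (flip_rev a), b; split=> //=.
    by rewrite size_flip_rev.
  exact: walk_flip_rev.
exists (Tuple sz_M, (Ordinal lt_a_n, m)) => //.
have [a' [b' [[/= defM sz_a' _] [_ _ fx]]]] := AP _ xA.
apply: val_inj; rewrite /= fx defw.
have/eqP := defM; rewrite eqseq_cat ?size_flip_rev ?sz_a' // => /andP[/eqP <-].
rewrite flip_revK => /eqP[] /(congr1 (drop (size (nseq m F)))).
by rewrite !drop_size_cat // => -[->].
Qed.

(** * Binomial formulas for humps and peaks *)

(** One binomial places the flat steps; the rest is the ballot number
    [(h+1)/(u+h+1) * C(2u+h, u)]. *)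
Lemma card_walks_bin u h f :
  (#|walks h (2 * u + h + f) f| * (u + h).+1 =
     h.+1 * 'C(2 * u + h + f, f) * 'C(2 * u + h, u))%N.
Proof.
have bin_f := bin_fact (leq_addl (2 * u + h) f).
have le_u : (u <= 2 * u + h)%N by lia.
have bin_u := bin_fact le_u.
rewrite addnK in bin_f.
rewrite (_ : 2 * u + h - u = u + h)%N in bin_u; last by lia.
apply/eqP; rewrite -(@eqn_pmul2r ((u + h)`! * u`! * f`!)%N); last first.
  by rewrite !muln_gt0 !fact_gt0.
apply/eqP; have := card_walks u h f; rewrite -bin_f -bin_u factS => E.
rewrite -mulnA !(mulnA (u + h).+1) E; ring.
Qed.

Lemma hockey_stick r j : (\sum_(m < j.+1) 'C(r + m, m) = 'C(r.+1 + j, j))%N.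
Proof.
elim: j => [|j IHj]; first by rewrite big_ord1 !bin0.
by rewrite big_ord_recr IHj /= !addSn addnS binS addnC.
Qed.

Lemma card_fibers (T : finType) (A : {set T}) (g : T -> nat) L :
  {in A, forall x, (g x < L)%N} ->
  #|A| = (\sum_(0 <= l < L) #|[set x in A | g x == l]|)%N.
Proof.
move=> ltL; under eq_bigr do rewrite -sum1dep_card big_mkcondr.
rewrite exchange_big -sum1_card; apply: eq_bigr => x xA /=.
rewrite -big_mkcond /=; under eq_bigl do rewrite eq_sym.
by rewrite big_nat1_eq ltL.
Qed.

Definition hump_fiber n K j m : {set n.-tuple step * ('I_n * 'I_n)} :=
  [set x in humps n K.+1 | (flats x.1 == j) && (x.2.2 == m :> nat)].

(** Deleting [U F^m] removes [m.+1] steps, [m] of them flat; a hump cannot have more flat steps than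
    its path. *)
Lemma card_hump_fiber n K j m : (m < n)%N ->
  #|hump_fiber n K j m| =
  if (m <= j)%N then #|walks (K.+1 + K) (n - m.+1) (j - m)| else 0%N.
Proof.
move=> lt_m_n; have defn : n = (n - m.+1 + m.+1)%N by lia.
rewrite /hump_fiber (card_humps_length n _ K j (Ordinal lt_m_n) defn).
case: leqP => le_mj.
  apply: eq_card => w; rewrite !inE; congr (_ && _); apply/eqP/eqP => /=; lia.
apply/eqP; rewrite cards_eq0; apply/eqP/setP=> w; rewrite !inE /=.
by apply/negP=> /andP[_ /eqP]; lia.
Qed.

Lemma card_hump_fiber_neq0 n K j m : (m < n)%N ->
  #|hump_fiber n K j m| <> 0%N ->
  exists u, (n = 2 * u + 2 * K.+1 + j)%N.
Proof.
move=> lt_m_n; rewrite card_hump_fiber //; case: leqP => // le_mj nz.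
case: (boolP (2 * K.+1 + j <= n)%N) => [le_n|lt_n]; last first.
  by case: nz; apply: walks_eq0 => u; lia.
case: (boolP (odd (n - j))) => [odd_nj|ev_nj].
  by case: nz; apply: walks_eq0 => u; lia.
by exists ((n - j)./2 - K.+1)%N; lia.
Qed.

(** Source of both the parity condition and the upper limit of the summation: the fiber containing
    [x] is nonempty. *)
Lemma humps_flats n K x : x \in humps n K.+1 ->
  exists u, (n = 2 * u + 2 * K.+1 + flats x.1)%N.
Proof.
move=> x_hump; apply: (@card_hump_fiber_neq0 _ _ _ x.2.2) => //.
apply/eqP; rewrite cards_eq0; apply/set0Pn; exists x.
by rewrite inE x_hump !eqxx.
Qed.

Lemma card_humps_flats n K j :
  #|[set x in humps n K.+1 | flats x.1 == j]| =
  (\sum_(0 <= m < n) #|hump_fiber n K j m|)%N.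
Proof.
pose g (x : n.-tuple step * ('I_n * 'I_n)) : nat := x.2.2.
rewrite (card_fibers _ _ g n); last by move=> x _; apply: ltn_ord.
apply: eq_bigr => m _; apply: eq_card => x.
by rewrite !inE -!andbA.
Qed.

Lemma card_humps_bin u K j n : n = (2 * u + 2 * K.+1 + j)%N ->
  (#|[set x in humps n K.+1 | flats x.1 == j]| * (u + 2 * K.+1) =
     2 * K.+1 * 'C(n, j) * 'C(2 * u + 2 * K.+1 - 1, u))%N.
Proof.
move=> defn; rewrite card_humps_flats.
rewrite (@big_cat_nat _ _ _ j.+1) /=; [|lia|lia].
have -> : (\sum_(j.+1 <= m < n) #|hump_fiber n K j m| = 0)%N.
  rewrite big_nat; apply: big1 => m /andP[lt_jm lt_mn].
  by rewrite card_hump_fiber // leqNgt lt_jm.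
rewrite addn0 big_distrl /=.
rewrite (eq_big_nat _ _ (F2 := fun m => 2 * K.+1 *
  'C(2 * u + (K.+1 + K) + (j - m), j - m) *
  'C(2 * u + (K.+1 + K), u)))%N; last first.
  move=> m /andP[_ lt_mj]; rewrite card_hump_fiber; last by lia.
  rewrite -ltnS lt_mj.
  have -> : (n - m.+1 = 2 * u + (K.+1 + K) + (j - m))%N by lia.
  have -> : (u + 2 * K.+1 = (u + (K.+1 + K)).+1)%N by lia.
  by rewrite card_walks_bin; congr (_ * _ * _)%N; lia.
(* Only one binomial depends on [m]; reversing the sum turns [j - m] into [m], as [hockey_stick]
   requires. *)
rewrite -big_distrl -big_distrr /= big_nat_rev /= big_mkord.
have -> : (2 * u + 2 * K.+1 - 1 = 2 * u + (K.+1 + K))%N by lia.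
congr (_ * _ * _)%N; rewrite defn.
have -> : (2 * u + 2 * K.+1 + j = (2 * u + (K.+1 + K)).+1 + j)%N by lia.
rewrite -hockey_stick; apply: eq_bigr => m _.
by have -> : (j - (0 + j.+1 - m.+1) = m)%N by have := ltn_ord m; lia.
Qed.

Lemma peaks_flatsE n K j :
  [set x in peaks n K.+1 | flats x.1 == j] = hump_fiber n K j 0.
Proof.
apply/setP=> x; rewrite !inE /is_peak.
have [-> /=|m0] := eqVneq (nat_of_ord x.2.2) 0%N; last by rewrite !andbF.
by rewrite !andbT.
Qed.

Lemma card_peaks_bin u K j n : n = (2 * u + 2 * K.+1 + j)%N ->
  (#|[set x in peaks n K.+1 | flats x.1 == j]| * (u + 2 * K.+1) =
     2 * K.+1 * 'C(n - 1, j) * 'C(2 * u + 2 * K.+1 - 1, u))%N.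
Proof.
move=> defn; rewrite peaks_flatsE card_hump_fiber; last by lia.
have -> : (2 * u + 2 * K.+1 - 1 = 2 * u + (K.+1 + K))%N by lia.
have -> : (n - 1 = 2 * u + (K.+1 + K) + j)%N by lia.
have -> : (u + 2 * K.+1 = (u + (K.+1 + K)).+1)%N by lia.
by rewrite leq0n subn0 card_walks_bin; congr (_ * _ * _)%N; lia.
Qed.

(** * Rational summands and the final sums *)

(** With [n - j = 2u + 2k] the fraction equals [2k/(u+2k)], and the last binomial is [C(2u+2k-1, u)]
    by symmetry. The factor [a] is left free to serve humps and peaks alike. *)
Lemma summandE c a u k j n : (0 < k)%N -> n = (2 * u + 2 * k + j)%N ->
  (c * (u + 2 * k) = 2 * k * a * 'C(2 * u + 2 * k - 1, u))%N ->
  c%:R = (j == n %[mod 2])%:R * ((4 * k)%:R / (n - j + 2 * k)%:R) * a%:R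
           * 'C(n - j - 1, (n - j) %/ 2 + k - 1)%:R :> rat.
Proof.
move=> k_gt0 defn E.
have -> : j == n %[mod 2] by lia.
have -> : (n - j - 1 = 2 * u + 2 * k - 1)%N by lia.
have -> : ((n - j) %/ 2 + k - 1 = 2 * u + 2 * k - 1 - u)%N by lia.
rewrite bin_sub; last by lia.
have -> : (n - j + 2 * k = 2 * (u + 2 * k))%N by lia.
have nz : (u + 2 * k)%:R != 0 :> rat by rewrite pnatr_eq0; lia.
apply: (mulIf nz); rewrite -natrM E mul1r !natrM.
by field; rewrite -natrM -natrD.
Qed.

(* The range 0 <= j < n.+1 - 2 * k is 0 <= j <= n - 2k, and is empty when
   n < 2k. *)
Theorem theorem1p1 (n k : nat) (hn : (2 <= n)%N) (hk : (1 <= k)%N) :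
  [/\ (HM n k)%:R = \sum_(0 <= j < n.+1 - 2 * k) hump_summand n k j,
      (PM n k)%:R = \sum_(0 <= j < n.+1 - 2 * k) peak_summand n k j
    & forall j : nat, (j + 2 * k <= n)%N ->
        #|[set x in humps n k | flats x.1 == j]|%:R = hump_summand n k j
        /\ #|[set x in peaks n k | flats x.1 == j]|%:R = peak_summand n k j].
Proof.
case: k hk => // K _.
have peak_hump x : x \in peaks n K.+1 -> x \in humps n K.+1.
  by rewrite !inE => /and3P[-> /andP[-> _] ->].
have flats_lt x : x \in humps n K.+1 -> (flats x.1 < n.+1 - 2 * K.+1)%N.
  by move=> /humps_flats[u]; lia.
have fibers j : (j + 2 * K.+1 <= n)%N ->
    #|[set x in humps n K.+1 | flats x.1 == j]|%:R = hump_summand n K.+1 j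
    /\ #|[set x in peaks n K.+1 | flats x.1 == j]|%:R = peak_summand n K.+1 j.
  move=> le_j; case: (boolP (j == n %[mod 2])) => [eq_jn | neq_jn].
    have defn : (n = 2 * ((n - j) %/ 2 - K.+1) + 2 * K.+1 + j)%N by lia.
    by split; apply: (summandE _ _ _ _ _ _ (ltn0Sn K) defn);
      [apply: card_humps_bin | apply: card_peaks_bin].
  (* For the wrong parity both sets are empty and the indicator vanishes. *)
  have no_hump : [set x in humps n K.+1 | flats x.1 == j] = set0.
    apply/setP=> x; rewrite [LHS]inE in_set0; apply/negP.
    by case/andP=> /humps_flats[u defn] /eqP flj; lia.
  have no_peak : [set x in peaks n K.+1 | flats x.1 == j] = set0.
    apply/setP=> x; rewrite [LHS]inE in_set0; apply/negP.
    by case/andP=> /peak_hump/humps_flats[u defn] /eqP flj; lia.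
  rewrite no_hump no_peak cards0 /hump_summand /peak_summand.
  by rewrite (negPf neq_jn) !mul0r.
split; last exact: fibers.
- rewrite /HM (card_fibers _ _ _ _ flats_lt) natr_sum.
  by apply: eq_big_nat => j lt_j; case: (fibers j) => //; lia.
- have flats_lt_peak x : x \in peaks n K.+1 -> (flats x.1 < n.+1 - 2 * K.+1)%N.
    by move=> /peak_hump/flats_lt.
  rewrite /PM (card_fibers _ _ _ _ flats_lt_peak) natr_sum.
  by apply: eq_big_nat => j lt_j; case: (fibers j) => //; lia.
Qed.
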